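(* Let $\mathbf{A},\mathbf{B}\in\mathbb{C}^{N\times N}$ and $\mathbf{U}\in\mathbb{C}^{N\times k}$ be such that $\mathbf{E}_{\mathbf{B}}:=\mathbf{U}^{\mathsf H}\mathbf{B}^{\mathsf H}\mathbf{A}\mathbf{U}\in\mathbb{C}^{k\times k}$ is nonsingular. Put $\mathcal{U}:=\mathrm{im}(\mathbf{U})$ and $$\mathbf{M}_{\mathbf{B}}:=\mathbf{U}\mathbf{E}_{\mathbf{B}}^{-1}\mathbf{U}^{\mathsf H},\qquad \mathbf{P}_{\mathbf{B}}:=\mathbf{I}-\mathbf{A}\mathbf{M}_{\mathbf{B}}\mathbf{B}^{\mathsf H},\qquad \mathbf{Q}_{\mathbf{B}}:=\mathbf{I}-\mathbf{M}_{\mathbf{B}}\mathbf{B}^{\mathsf H}\mathbf{A}.$$ Let $\widehat{\mathbf{A}}\in\mathbb{C}^{N\times N}$, $\widehat{\mathbf{v}}\in\mathbb{C}^N$ and an integer $n\ge 1$ be such that the Krylov subspace $\mathcal{K}_n(\widehat{\mathbf{A}},\widehat{\mathbf{v}})$ has dimension $n$, and let $\mathbf{b},\mathbf{x}_0\in\mathbb{C}^N$ be arbitrary. Consider the two pairs of conditions $$\text{(E)}\quad \mathbf{x}_n\in\mathbf{x}_0+\mathcal{K}_n(\widehat{\mathbf{A}},\widehat{\mathbf{v}})+\mathcal{U},\qquad \mathbf{r}_n:=\mathbf{b}-\mathbf{A}\mathbf{x}_n\perp \mathbf{B}\mathcal{K}_n(\widehat{\mathbf{A}},\widehat{\mathbf{v}})+\mathbf{B}\mathcal{U},$$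 and $$\text{(I)}\quad \widehat{\mathbf{x}}_n\in\mathbf{x}_0+\mathcal{K}_n(\widehat{\mathbf{A}},\widehat{\mathbf{v}}),\qquad \widehat{\mathbf{r}}_n:=\mathbf{P}_{\mathbf{B}}(\mathbf{b}-\mathbf{A}\widehat{\mathbf{x}}_n)\perp\mathbf{B}\mathcal{K}_n(\widehat{\mathbf{A}},\widehat{\mathbf{v}}).$$ Then (E) and (I) are equivalent in the sense that $$\mathbf{x}_n=\mathbf{Q}_{\mathbf{B}}\widehat{\mathbf{x}}_n+\mathbf{M}_{\mathbf{B}}\mathbf{B}^{\mathsf H}\mathbf{b}\qquad\text{and}\qquad \mathbf{r}_n=\widehat{\mathbf{r}}_n.$$ That is: if $\widehat{\mathbf{x}}_n$ satisfies (I), then $\mathbf{x}_n:=\mathbf{Q}_{\mathbf{B}}\widehat{\mathbf{x}}_n+\mathbf{M}_{\mathbf{B}}\mathbf{B}^{\mathsf H}\mathbf{b}$ satisfies (E) and $\mathbf{r}_n=\widehat{\mathbf{r}}_n$; conversely, if $\mathbf{x}_n$ satisfies (E), then there is a vector $\widehat{\mathbf{x}}_n$ satisfying (I) with $\mathbf{x}_n=\mathbf{Q}_{\mathbf{B}}\widehat{\mathbf{x}}_n+\mathbf{M}_{\mathbf{B}}\mathbf{B}^{\mathsf H}\mathbf{b}$ and $\mathbf{r}_n=\widehat{\mathbf{r}}_n$.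
   Context: For $\mathbf{C}\in\mathbb{C}^{N\times N}$ and $\mathbf{v}\in\mathbb{C}^N$, $\mathcal{K}_n(\mathbf{C},\mathbf{v}):=\mathrm{span}\{\mathbf{v},\mathbf{C}\mathbf{v},\dots,\mathbf{C}^{n-1}\mathbf{v}\}$. The symbol $\perp$ denotes orthogonality with respect to the Euclidean inner product on $\mathbb{C}^N$, $^{\mathsf H}$ is the conjugate transpose, $\mathbf{I}$ is the identity matrix, $\mathrm{im}$ denotes the column space, and $0<k<N$. *)

(* Defs.v *)
From HB Require Import structures.
From mathcomp Require Import all_boot all_order all_algebra.
From mathcomp Require Export complex.
From mathcomp Require Export reals.

Set Implicit Arguments.
Unset Strict Implicit.
Unset Printing Implicit Defensive.

Import Order.TTheory GRing.Theory Num.Theory.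
Local Open Scope ring_scope.
Local Open Scope sesquilinear_scope.

(* [dotmx] is MathComp's Euclidean inner product on row vectors, linear in its
   first argument: cdot u v = \sum_i u_i * (v_i)^*.                           *)
Definition cdot (C : numClosedFieldType) (N : nat) (u v : 'cV[C]_N) : C :=
  dotmx u^T v^T.

Definition orthv (C : numClosedFieldType) (N : nat)
    (r : 'cV[C]_N) (W : {vspace 'cV[C]_N}) : Prop :=
  forall w : 'cV[C]_N, w \in W -> cdot r w = 0.

Definition mxhom (C : numClosedFieldType) (m n : nat) (A : 'M[C]_(m, n)) :
    'Hom('cV[C]_n, 'cV[C]_m) :=
  linfun (mulmx A : 'cV[C]_n -> 'cV[C]_m).

Definition mxim (C : numClosedFieldType) (m n : nat) (A : 'M[C]_(m, n)) :
    {vspace 'cV[C]_m} :=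
  limg (mxhom A).

Definition krylov (C : numClosedFieldType) (N : nat)
    (n : nat) (A : 'M[C]_N) (v : 'cV[C]_N) : {vspace 'cV[C]_N} :=
  <<[seq A ^+ j *m v | j <- iota 0 n]>>%VS.

Definition matE (C : numClosedFieldType) (N k : nat)
    (A B : 'M[C]_N) (U : 'M[C]_(N, k)) : 'M[C]_k :=
  U^t* *m B^t* *m A *m U.

Definition matM (C : numClosedFieldType) (N k : nat)
    (A B : 'M[C]_N) (U : 'M[C]_(N, k)) : 'M[C]_N :=
  U *m invmx (matE A B U) *m U^t*.

Definition matP (C : numClosedFieldType) (N k : nat)
    (A B : 'M[C]_N) (U : 'M[C]_(N, k)) : 'M[C]_N :=
  1%:M - A *m matM A B U *m B^t*.

Definition matQ (C : numClosedFieldType) (N k : nat)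
    (A B : 'M[C]_N) (U : 'M[C]_(N, k)) : 'M[C]_N :=
  1%:M - matM A B U *m B^t* *m A.

Definition resid (C : numClosedFieldType) (N : nat)
    (A : 'M[C]_N) (b x : 'cV[C]_N) : 'cV[C]_N :=
  b - A *m x.

Definition defl_resid (C : numClosedFieldType) (N k : nat)
    (A B : 'M[C]_N) (U : 'M[C]_(N, k)) (b x : 'cV[C]_N) : 'cV[C]_N :=
  matP A B U *m (b - A *m x).

(* Membership in an affine subspace x0 + W is expressed as x - x0 \in W. *)
Definition condE (C : numClosedFieldType) (N k : nat)
    (A B : 'M[C]_N) (U : 'M[C]_(N, k)) (K : {vspace 'cV[C]_N})
    (b x0 x : 'cV[C]_N) : Prop :=
  x - x0 \in (K + mxim U)%VS /\
  orthv (resid A b x) (mxhom B @: K + mxhom B @: mxim U)%VS.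

Definition condI (C : numClosedFieldType) (N k : nat)
    (A B : 'M[C]_N) (U : 'M[C]_(N, k)) (K : {vspace 'cV[C]_N})
    (b x0 x : 'cV[C]_N) : Prop :=
  x - x0 \in K /\
  orthv (defl_resid A B U b x) (mxhom B @: K)%VS.

Lemma cdotE (C : numClosedFieldType) (N : nat) (u v : 'cV[C]_N) :
  cdot u v = \sum_i u i 0 * (v i 0)^*.
Proof. by rewrite /cdot dotmxE mxE; apply: eq_bigr => i _; rewrite !mxE. Qed.

Lemma mxhomE (C : numClosedFieldType) (m n : nat) (A : 'M[C]_(m, n))
    (v : 'cV[C]_n) :
  mxhom A v = A *m v.
Proof. by rewrite lfunE. Qed.

(* Main.v *)
(** Both conditions are linked by x = xhat + M_B B^H (b - A xhat), for which
    b - A x = P_B (b - A xhat).  The correction lies in U, and it is the only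
    element z of U for which the residual of xhat + z is orthogonal to B U: for
    z = U y, that orthogonality reads E_B y = U^H B^H (b - A xhat). *)
Require Import Defs.
From mathcomp Require Import all_boot all_order all_algebra.
From mathcomp Require Import complex reals.

Local Open Scope ring_scope.
Local Open Scope sesquilinear_scope.
Local Open Scope complex_scope.

Import GRing.Theory Num.Theory.

Lemma cdot_mxE (C : numClosedFieldType) (N : nat) (u v : 'cV[C]_N) :
  cdot u v = (v^t* *m u) 0 0.
Proof. by rewrite cdotE mxE; apply: eq_bigr => i _; rewrite !mxE mulrC. Qed.

Lemma cdotDr (C : numClosedFieldType) (N : nat) (u v w : 'cV[C]_N) :
  cdot u (v + w) = cdot u v + cdot u w.
Proof. by rewrite !cdot_mxE linearD map_mxD mulmxDl mxE. Qed.

Lemma cdot_mulmxr (C : numClosedFieldType) (m N : nat) (V : 'M[C]_(N, m))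
    (u : 'cV[C]_N) (w : 'cV[C]_m) :
  cdot u (V *m w) = cdot (V^t* *m u) w.
Proof. by rewrite !cdot_mxE trmx_mul map_mxM mulmxA. Qed.

Lemma cdot_delta (C : numClosedFieldType) (N : nat) (u : 'cV[C]_N) (i : 'I_N) :
  cdot u (delta_mx i 0) = u i 0.
Proof.
rewrite cdotE (bigD1 i) //= mxE !eqxx conjC1 mulr1 big1 ?addr0 // => j ji.
by rewrite mxE (negPf ji) conjC0 mulr0.
Qed.

Lemma orthvD (C : numClosedFieldType) (N : nat) (r : 'cV[C]_N)
    (V W : {vspace 'cV[C]_N}) :
  orthv r (V + W)%VS <-> orthv r V /\ orthv r W.
Proof.
split=> [rVW | [rV rW] _ /memv_addP[v Vv [w Ww ->]]].
  by split=> w Ww; apply: rVW; rewrite (subvP _ _ Ww) ?addvSl ?addvSr.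
by rewrite cdotDr rV // rW // addr0.
Qed.

Lemma mximP (C : numClosedFieldType) (m N : nat) (V : 'M[C]_(N, m))
    (w : 'cV[C]_N) :
  reflect (exists y, w = V *m y) (w \in mxim V).
Proof.
apply: (iffP memv_imgP) => [[y _ ->] | [y ->]]; exists y; rewrite ?mxhomE //.
exact: memvf.
Qed.

(** Adjointness turns [cdot r (B *m (V *m y))] into the inner product of V^H B^H r with y.
    Orthogonality thus becomes a matrix equation, the form in which E_B appears once V = U. *)
Lemma orthv_img_mxim (C : numClosedFieldType) (m N : nat) (B : 'M[C]_N)
    (V : 'M[C]_(N, m)) (r : 'cV[C]_N) :
  orthv r (mxhom B @: mxim V)%VS <-> V^t* *m B^t* *m r = 0.
Proof.
split=> [rBV | r0 _ /memv_imgP[_ /mximP[y ->] ->]].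
  (* Coordinate i of V^H B^H r is the inner product of r with B V e_i. *)
  apply/colP => i; rewrite [RHS]mxE -cdot_delta -mulmxA -!cdot_mulmxr -mxhomE.
  by apply/rBV/memv_img/mximP; exists (delta_mx i 0).
by rewrite mxhomE !cdot_mulmxr mulmxA r0 cdot_mxE mulmx0 mxE.
Qed.

Section Deflation.
Variables (C : numClosedFieldType) (N k : nat).
Variables (A B : 'M[C]_N) (U : 'M[C]_(N, k)).

(** Collecting the terms in M_B B^H isolates the correction added to [x]; the affine membership in
    (E) and the residual are both read off this form. *)
Lemma matQ_affineE (b x : 'cV[C]_N) :
  matQ A B U *m x + matM A B U *m B^t* *m b =
  x + matM A B U *m B^t* *m (b - A *m x).
Proof.
by rewrite /matQ mulmxBl mul1mx mulmxBr !mulmxA addrAC addrA.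
Qed.

(** With r = b - A x, adding the correction M_B B^H r to [x] leaves the residual r - A M_B B^H r,
    which is P_B r. *)
Lemma resid_deflated (b x : 'cV[C]_N) :
  resid A b (matQ A B U *m x + matM A B U *m B^t* *m b) =
  defl_resid A B U b x.
Proof.
by rewrite matQ_affineE /resid /defl_resid /matP mulmxDr opprD addrA
  [RHS]mulmxBl mul1mx !mulmxA.
Qed.

Lemma mem_matM_mxim (v : 'cV[C]_N) : matM A B U *m v \in mxim U.
Proof. by apply/mximP; eexists; rewrite -!mulmxA. Qed.

Hypothesis E_unit : matE A B U \in unitmx.

(** Since U^H B^H A M_B = E_B E_B^{-1} U^H = U^H, the two terms of the product cancel. Hence every
    deflated residual is orthogonal to B im(U). *)
Lemma matP_annihilated : U^t* *m B^t* *m matP A B U = 0.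
Proof.
rewrite /matP /matM mulmxBr mulmx1 !mulmxA -/(matE A B U).
by rewrite mulmxV // mul1mx subrr.
Qed.

(** Uniqueness of the correction: multiplying the equation for E_B y by U E_B^{-1} recovers U y. *)
Lemma matM_correction (b x : 'cV[C]_N) (y : 'cV[C]_k) :
  U^t* *m B^t* *m resid A b (x + U *m y) = 0 ->
  matM A B U *m B^t* *m (b - A *m x) = U *m y.
Proof.
rewrite /resid (mulmxDr A) opprD addrA mulmxBr => /subr0_eq.
have -> : U^t* *m B^t* *m (A *m (U *m y)) = matE A B U *m y by rewrite !mulmxA.
move=> corr.
by rewrite /matM -(mulmxA _ (U^t* )) -mulmxA corr -mulmxA mulKmx.
Qed.

Theorem condI_condE (K : {vspace 'cV[C]_N}) (b x0 xhat : 'cV[C]_N) :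
  condI A B U K b x0 xhat ->
  condE A B U K b x0 (matQ A B U *m xhat + matM A B U *m B^t* *m b).
Proof.
case=> Kx orthK; split.
  by rewrite matQ_affineE addrAC memv_add // -mulmxA mem_matM_mxim.
(* Orthogonality to B K is the one assumed in (I); only the part against B im(U) remains. *)
rewrite resid_deflated; apply/orthvD; split=> //; apply/orthv_img_mxim.
by rewrite mulmxA matP_annihilated mul0mx.
Qed.

Theorem condE_condI (K : {vspace 'cV[C]_N}) (b x0 x : 'cV[C]_N) :
  condE A B U K b x0 x ->
  exists2 xhat, condI A B U K b x0 xhat &
    x = matQ A B U *m xhat + matM A B U *m B^t* *m b.
Proof.
(* Split x - x0 = w + U y with w in K, and drop the second part: the witness is x0 + w. Any such
   splitting serves, as orthogonality to B im(U) forces U y to be the correction of x0 + w. *)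
case=> /memv_addP[w Kw [_ /mximP[y ->] x_x0]] /orthvD[orthK /orthv_img_mxim].
have def_x : x = (x0 + w) + U *m y by rewrite -addrA -x_x0 addrC subrK.
rewrite def_x => /matM_correction corr.
have xE : x = matQ A B U *m (x0 + w) + matM A B U *m B^t* *m b.
  by rewrite matQ_affineE corr.
exists (x0 + w); last by rewrite -def_x.
by split; [rewrite addrC addKr | rewrite -resid_deflated -xE].
Qed.

End Deflation.

Theorem theorem3p2 (R : realType) (N k n : nat) (hk : (0 < k < N)%N)
    (A B : 'M[R[i]]_N) (U : 'M[R[i]]_(N, k)) (hE : matE A B U \in unitmx)
    (Ahat : 'M[R[i]]_N) (vhat : 'cV[R[i]]_N) (hn : (1 <= n)%N)
    (hdim : \dim (krylov n Ahat vhat) = n) (b x0 : 'cV[R[i]]_N) :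
  (forall xhat : 'cV[R[i]]_N,
     condI A B U (krylov n Ahat vhat) b x0 xhat ->
     let x := matQ A B U *m xhat + matM A B U *m B^t* *m b in
     condE A B U (krylov n Ahat vhat) b x0 x /\
     resid A b x = defl_resid A B U b xhat) /\
  (forall x : 'cV[R[i]]_N,
     condE A B U (krylov n Ahat vhat) b x0 x ->
     exists xhat : 'cV[R[i]]_N,
       [/\ condI A B U (krylov n Ahat vhat) b x0 xhat,
           x = matQ A B U *m xhat + matM A B U *m B^t* *m b &
           resid A b x = defl_resid A B U b xhat]).
Proof.
split=> [xhat Ixhat x | x /condE_condI[//|xhat Ixhat ->]].
  by split; [apply: condI_condE | apply: resid_deflated].
by exists xhat; split=> //; apply: resid_deflated.
Qed.
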